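(* If a hereditary family of graphs has the $B_2$ property, then it also has the $B_k$ property for all integers $k\ge 2$.
   Context: All graphs are finite and simple. A family of graphs $\mathcal{G}$ is hereditary if for every $G\in\mathcal{G}$, every induced subgraph of $G$ belongs to $\mathcal{G}$. $\varrho_k(G)$ is the number of copies of $K_k$ in $G$ divided by $\binom{|V(G)|}{k}$. $K_k[t]$ is the complete $k$-partite graph with all parts of size $t$; containing it means as a not necessarily induced subgraph; for non-integer $t$ read $\lfloor t\rfloor$. For $k\ge 2$, a graph class $\mathcal{G}$ has the $B_k$ property with function $f:\mathbb{R}^+\to\mathbb{R}^+$ if for any $\varepsilon>0$ and any $n$-vertex $G\in\mathcal{G}$ with $\varrho_k(G)>\varepsilon$, $G$ contains a $K_k[f(\varepsilon)n]$. $\mathcal{G}$ has the $B_k$ property if it has the $B_k$ property with some function $f:\mathbb{R}^+\to\mathbb{R}^+$. *)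

(* Defs.v *)
From HB Require Import structures.
From mathcomp Require Import all_boot all_order all_algebra.
From mathcomp Require Import reals.

Set Implicit Arguments.
Unset Strict Implicit.
Unset Printing Implicit Defensive.

Import Order.TTheory GRing.Theory Num.Theory.

Local Open Scope ring_scope.

Record sgraph := SGraph {
  vertex :> finType;
  adj : rel vertex;
  adj_sym : symmetric adj;
  adj_irrefl : irreflexive adj }.

Section Induced.
Variables (G : sgraph) (S : {set G}).

Definition induced_adj : rel {x : G | x \in S} :=
  fun u v => adj (val u) (val v).

Lemma induced_adj_sym : symmetric induced_adj.
Proof. by move=> u v; apply: adj_sym. Qed.

Lemma induced_adj_irrefl : irreflexive induced_adj.
Proof. by move=> u; apply: adj_irrefl. Qed.

Definition induced : sgraph := SGraph induced_adj_sym induced_adj_irrefl.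
End Induced.

Definition hereditary (F : sgraph -> Prop) : Prop :=
  forall G : sgraph, F G -> forall S : {set G}, F (induced S).

Section CompleteMultipartite.
Variables k t : nat.

Definition multipartite_adj : rel ('I_k * 'I_t) := fun u v => u.1 != v.1.

Lemma multipartite_adj_sym : symmetric multipartite_adj.
Proof. by move=> u v; rewrite /multipartite_adj eq_sym. Qed.

Lemma multipartite_adj_irrefl : irreflexive multipartite_adj.
Proof. by move=> u; rewrite /multipartite_adj eqxx. Qed.

(* K_k[t]; the part of a vertex is its first component. *)
Definition complete_multipartite : sgraph :=
  SGraph multipartite_adj_sym multipartite_adj_irrefl.
End CompleteMultipartite.

(* Containment as a not necessarily induced subgraph. *)
Definition contains (G H : sgraph) : Prop :=
  exists phi : H -> G,
    injective phi /\ forall u v : H, adj u v -> adj (phi u) (phi v).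

Definition clique (G : sgraph) (S : {set G}) : bool :=
  [forall u in S, forall v in S, (u != v) ==> adj u v].

(* A copy of K_k in G is determined by its vertex set. *)
Definition num_cliques (k : nat) (G : sgraph) : nat :=
  #|[set S : {set G} | (#|S| == k) && clique S]|.

(* When #|G| < k the quotient is 0 / 0 = 0, so that no such graph has density
   greater than a positive epsilon. *)
Definition clique_density (R : realType) (k : nat) (G : sgraph) : R :=
  (num_cliques k G)%:R / 'C(#|G|, k)%:R.

(* Num.truncn is the floor on nonnegative reals. *)
Definition B_property_with (R : realType) (k : nat) (F : sgraph -> Prop)
    (f : R -> R) : Prop :=
  forall eps : R, 0 < eps ->
  forall G : sgraph, F G -> eps < clique_density R k G ->
    contains G (complete_multipartite k (Num.truncn (f eps * #|G|%:R))).

(* Functions from R^+ to R^+ are total functions on R mapping positive reals to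
   positive reals; their values elsewhere are irrelevant. *)
Definition B_property (R : realType) (k : nat) (F : sgraph -> Prop) : Prop :=
  exists f : R -> R,
    (forall eps : R, 0 < eps -> 0 < f eps) /\ B_property_with k F f.

(* Main.v *)
Require Import Defs.
From mathcomp Require Import all_boot all_order all_algebra.
From mathcomp Require Import reals.
From mathcomp Require Import boolp.
From mathcomp Require Import zify lra ring.

(* By B_2, an induced subgraph of positive density contains a complete pair of
   linear size; iterating inside one side, every vertex set contains either k
   mutually complete sets of linear size or a linear-size set of arbitrarily
   small density.  In a k-tuple of sets of equal size whose clique transversals
   have density at least d, we may thus assume that each set has a sparse
   subset.  If these subsets are lower-regular (subsets of comparable size of two
   of them span density at least d0/2, where d0 <= d is the initial density),
   then applying B_2 to the union of two of them yields a biclique, which by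
   sparsity must run between the two; doing so for each pair in turn gives the
   k parts.  Otherwise some pair of large subsets A, B is too sparse, and leaving
   A x B out raises the transversal density by a factor 1 + gamma with gamma
   depending only on d0 and k, which can happen only boundedly often. *)

Set Implicit Arguments.
Unset Strict Implicit.
Unset Printing Implicit Defensive.

Import Order.TTheory GRing.Theory Num.Theory.

Local Open Scope ring_scope.

(** * Edge counts and complete pairs of vertex sets *)

(** Ordered pairs are counted, so [edges V V] is twice the number of edges inside [V]. *)
Definition edges (G : sgraph) (A B : {set G}) : nat :=
  (\sum_(u in A) \sum_(v in B) adj u v)%N.

Definition complete (G : sgraph) (A B : {set G}) : Prop :=
  forall u v, u \in A -> v \in B -> adj u v.

(** Disjointness of the [A i] follows from completeness, as adjacency is irreflexive. *)
Definition has_parts (R : realType) (k : nat) (G : sgraph) (V : {set G})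
    (s : R) : Prop :=
  exists A : 'I_k -> {set G},
    (forall i, A i \subset V /\ s <= #|A i|%:R) /\
    (forall i j, i != j -> complete (A i) (A j)).

(** $B_2$ transferred to vertex subsets, with density measured against $|V|^2$ and no floor in the
    sizes. *)
Definition dense_biclique (R : realType) (F : sgraph -> Prop) : Prop :=
  forall eps : R, 0 < eps -> exists delta : R, 0 < delta <= 1 /\
  forall G, F G -> forall V : {set G}, V != set0 ->
    eps * #|V|%:R ^+ 2 <= (edges V V)%:R ->
    exists A B : {set G}, [/\ A \subset V, B \subset V,
      delta * #|V|%:R <= #|A|%:R, delta * #|V|%:R <= #|B|%:R & complete A B].

Lemma subset_card (T : finType) (A : {set T}) (s : nat) :
  (s <= #|A|)%N -> exists2 B : {set T}, B \subset A & #|B| = s.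
Proof.
move=> sA; exists [set x in take s (enum A)].
  by apply/subsetP => x; rewrite inE => /mem_take; rewrite mem_enum.
rewrite cardsE (card_uniqP _) ?take_uniq ?enum_uniq // size_take -cardE.
by case: ltngtP sA.
Qed.

Lemma edges_setXE (G : sgraph) (A B : {set G}) :
  edges A B = #|[set p in setX A B | adj p.1 p.2]|.
Proof.
rewrite /edges pair_big_dep /= -sum1dep_card big_mkcond [RHS]big_mkcond /=.
apply: eq_bigr => -[u v] _ /=; rewrite !inE /=.
by case: (u \in A); case: (v \in B); case: (adj u v).
Qed.

Lemma edges_mono (G : sgraph) (A B A' B' : {set G}) :
  A \subset A' -> B \subset B' -> (edges A B <= edges A' B')%N.
Proof.
move=> sA sB; rewrite !edges_setXE; apply/subset_leq_card/subsetP => -[u v].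
by rewrite !inE /= => /andP[/andP[uA vB] ->]; rewrite (subsetP sA) ?(subsetP sB).
Qed.

Lemma edges_complete (G : sgraph) (A B : {set G}) :
  complete A B -> edges A B = (#|A| * #|B|)%N.
Proof.
move=> cAB; rewrite edges_setXE -cardsX; apply: eq_card => -[u v]; rewrite !inE /=.
by apply: andb_idr => /andP[uA vB]; apply: cAB.
Qed.

Lemma complete_sub (G : sgraph) (A B A' B' : {set G}) :
  A' \subset A -> B' \subset B -> complete A B -> complete A' B'.
Proof. by move=> /subsetP sA /subsetP sB c u v /sA uA /sB; apply: c. Qed.

Lemma complete_sym (G : sgraph) (A B : {set G}) :
  complete A B -> complete B A.
Proof. by move=> c u v uB vA; rewrite adj_sym; apply: c. Qed.

(** * The $B_2$ property for vertex subsets *)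

(** An adjacent ordered pair $(u,v)$ lies in the square $S\times S$ of the 2-clique $S=\{u,v\}$,
    which has 4 elements. The lost factor 2 does no harm. *)
Lemma edges_le_num_cliques2 (G : sgraph) (V : {set G}) :
  (edges V V <= 4 * num_cliques 2 (induced V))%N.
Proof.
pose I := induced V.
pose E := [set p : I * I | adj p.1 p.2].
have -> : edges V V = #|E|.
  have -> : edges V V = #|[set (val p.1, val p.2) | p in E]|.
    rewrite edges_setXE; apply: eq_card => -[u v]; rewrite !inE /=.
    apply/andP/imsetP => [[/andP[uV vV] uv]|[[a b]]].
      by exists (exist _ u uV, exist _ v vV); rewrite // inE.
    by rewrite inE /= => ab [-> ->]; split; [rewrite (valP a) (valP b)|].
  by rewrite card_imset // => -[a b] [c d] [] /= /val_inj -> /val_inj ->.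
pose C := [set S : {set I} | (#|S| == 2) && clique S].
have sEC : E \subset \bigcup_(S in C) setX S S.
  apply/subsetP => -[u v]; rewrite inE /= => uv; apply/bigcupP.
  exists [set u; v]; last by rewrite !inE !eqxx orbT.
  have nuv : u != v by apply: contraTneq uv => ->; apply/negbT/(@adj_irrefl I).
  rewrite inE cards2 nuv /=; apply/forall_inP => a; rewrite !inE => ha.
  apply/forall_inP => b; rewrite !inE => hb; apply/implyP.
  case/orP: ha => /eqP ->; case/orP: hb => /eqP ->; rewrite ?eqxx //.
  by rewrite adj_sym.
apply: (leq_trans (subset_leq_card sEC)).
have h : (#|\bigcup_(S in C) setX S S| <= \sum_(S in C) #|setX S S|)%N.
  elim/big_rec2: _ => [|S n W _ le]; first by rewrite cards0.
  by apply: leq_trans (leq_card_setU _ _) _; rewrite leq_add2l.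
apply: (leq_trans h).
rewrite (eq_bigr (fun => 4%N)); first by rewrite sum_nat_const mulnC.
by move=> S; rewrite inE cardsX => /andP[/eqP -> _].
Qed.

Lemma dense_biclique_of_B2 (R : realType) (F : sgraph -> Prop) :
  hereditary F -> B_property R 2 F -> dense_biclique R F.
Proof.
move=> herF [f [f0 Bf]] eps eps0.
have e40 : 0 < eps / 4 by lra.
(* Halving absorbs the floor, since $\lfloor x\rfloor\ge x/2$ for $x\ge1$. *)
pose delta : R := Num.min 1 (f (eps / 4) / 2).
have fe0 := f0 _ e40.
have d0 : 0 < delta by rewrite /delta lt_min; lra.
have d1 : delta <= 1 by rewrite /delta ge_min lexx.
have d2 : delta <= f (eps / 4) / 2 by rewrite /delta ge_min lexx orbT.
exists delta; split; first by rewrite d0.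
move=> G FG V V0 hV.
have n0 : 0 < #|V|%:R :> R by rewrite ltr0n card_gt0.
have cI : #|induced V| = #|V| by rewrite card_sig; apply: eq_card.
(* If $f(\varepsilon/4)|V|<1$, the floor is 0 and $B_2$ gives nothing; then a single edge is large
   enough, as $\delta|V|\le1$. *)
have [ge1|lt1] := leP 1 (f (eps / 4) * #|V|%:R); last first.
  have : (0 < edges V V)%N.
    rewrite -(ltr0n R); apply: lt_le_trans hV.
    by rewrite mulr_gt0 // exprn_gt0.
  rewrite edges_setXE card_gt0 => /set0Pn [[u v]]; rewrite !inE /=.
  move=> /andP[/andP[uV vV] uv]; exists [set u], [set v].
  have le1 : delta * #|V|%:R <= 1 by nra.
  rewrite !sub1set uV vV !cards1; split=> // a b /set1P -> /set1P ->; exact: uv.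
have Fi := herF _ FG V.
have dens : eps / 4 < clique_density R 2 (induced V).
  have := edges_le_num_cliques2 V; rewrite -(ler_nat R) natrM => le4.
  have n2 : (1 < #|V|)%N.
    rewrite ltnNge; apply/negP => n1.
    have e0 : edges V V = 0%N.
      have/card_le1_eqP V1 := n1.
      rewrite /edges big1 // => u uV; rewrite big1 // => v vV.
      by rewrite (V1 v u vV uV) adj_irrefl.
    by move: hV; rewrite e0 leNgt mulr_gt0 // exprn_gt0.
  rewrite /clique_density cI.
  have C0 : 0 < 'C(#|V|, 2)%:R :> R by rewrite ltr0n bin_gt0.
  rewrite ltr_pdivlMr //.
  have C2 : 2 * 'C(#|V|, 2)%:R = #|V|%:R * (#|V|%:R - 1) :> R.
    rewrite -natrM -[#|V|%:R - 1](_ : #|V|.-1%:R = _); last first.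
      by rewrite -subn1 natrB //; apply: ltnW.
    by rewrite -natrM -mul_bin_diag bin1.
  nra.
have [phi [iphi aphi]] := Bf _ e40 _ Fi dens.
rewrite cI in phi iphi aphi *.
set t := Num.truncn _ in phi iphi aphi.
have ht : delta * #|V|%:R <= t%:R.
  have := truncnS_gt (f (eps / 4) * #|V|%:R); rewrite -/t -[t.+1]addn1 (natrD _ t 1) => lt1.
  have t1 : 1 <= t%:R :> R by rewrite ler1n truncn_gt0.
  have := ler_wpM2r (ltW n0) d2; lra.
pose A (i : 'I_2) := [set val (phi (i, a)) | a : 'I_t].
have AV i : A i \subset V.
  by apply/subsetP => _ /imsetP[a _ ->]; apply: valP.
have cA i : #|A i| = t.
  by rewrite card_imset ?card_ord // => a b /val_inj /iphi [].
exists (A ord0), (A ord_max); rewrite !AV !cA; split=> //.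
by move=> _ _ /imsetP[a _ ->] /imsetP[b _ ->]; apply: aphi.
Qed.

(** * Sparse subsets of linear size *)

(** Induction on [k]: if [V] is not itself sparse, take a biclique [A], [B] in it, keep [A] as a
    part and look for the others inside [B]. *)
Lemma sparse_or_parts (R : realType) (F : sgraph -> Prop) (eta : R) (k : nat) :
  dense_biclique R F -> 0 < eta ->
  exists delta : R, 0 < delta <= 1 /\
  forall G, F G -> forall V : {set G}, V != set0 ->
    has_parts k V (delta * #|V|%:R) \/
    exists X : {set G}, [/\ X \subset V, delta * #|V|%:R <= #|X|%:R &
      (edges X X)%:R <= eta * #|X|%:R ^+ 2].
Proof.
move=> bF eta0; elim: k => [|k [d [/andP[d0 d1] IH]]].
  exists 1; split; first by rewrite ltr01 lexx.
  move=> G _ V _; left; exists (fun=> set0).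
  by split=> [[]|[]].
have [e [/andP[e0 e1] He]] := bF _ eta0.
have ed0 : 0 < e * d by rewrite mulr_gt0.
have edle : e * d <= e by rewrite ler_piMr // ltW.
exists (e * d); split; first by rewrite ed0 (le_trans edle).
move=> G FG V V0.
have n0 : 0 < #|V|%:R :> R by rewrite ltr0n card_gt0.
have [sp|ds] := leP (edges V V)%:R (eta * #|V|%:R ^+ 2).
  right; exists V; split=> //.
  by rewrite ger_pMl // (le_trans edle).
have [A [B [AV BV hA hB cAB]]] := He G FG V V0 (ltW ds).
have B0 : B != set0.
  rewrite -card_gt0 -(ltr0n R); apply: lt_le_trans hB; exact: mulr_gt0.
have le2 : e * d * #|V|%:R <= d * #|B|%:R.
  by rewrite (mulrC e) -mulrA ler_wpM2l // ltW.
have [[P [Ps Pc]]|[X [XB hX sX]]] := IH G FG B B0; last first.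
  right; exists X; split=> //; first exact: subset_trans BV.
  exact: le_trans hX.
left; exists (fun i => oapp P A (unlift ord0 i)); split=> [i|i j].
  case: unliftP => [i' _|_] /=.
    by have [s1 s2] := Ps i'; rewrite (subset_trans s1 BV) (le_trans le2 s2).
  by rewrite AV (le_trans _ hA) // ler_wpM2r // ltW.
case: unliftP => [i' ->|->]; case: unliftP => [j' ->|->] //=; rewrite ?eqxx //.
- by rewrite (inj_eq lift_inj); apply: Pc.
- by move=> _; apply: complete_sym; apply: complete_sub cAB => //; have [] := Ps i'.
- by move=> _; apply: complete_sub cAB => //; have [] := Ps j'.
Qed.

(** * Averaging: subsets of prescribed size *)

Lemma exists_ge_average (T : finType) (w : T -> nat) (A : {set T}) :
  A != set0 -> exists2 v, v \in A & (\sum_(u in A) w u <= #|A| * w v)%N.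
Proof.
move=> /set0Pn[x xA]; case: (arg_maxnP w xA) => v vA mx; exists v => //.
by rewrite -sum_nat_const; apply: leq_sum.
Qed.

Lemma exists_le_average (T : finType) (w : T -> nat) (A : {set T}) :
  A != set0 -> exists2 v, v \in A & (#|A| * w v <= \sum_(u in A) w u)%N.
Proof.
move=> /set0Pn[x xA]; case: (arg_minnP w xA) => v vA mx; exists v => //.
by rewrite -sum_nat_const; apply: leq_sum.
Qed.

Lemma edges_setD1 (G : sgraph) (X : {set G}) (v : G) : v \in X ->
  edges X X = (edges (X :\ v) (X :\ v) + 2 * \sum_(u in X) adj v u)%N.
Proof.
move=> vX; rewrite /edges.
under eq_bigr do rewrite (big_setD1 v vX) /=.
rewrite big_split /= [X in (_ + X)%N](big_setD1 v vX) /= addnA addnC.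
congr (_ + _)%N; rewrite mul2n -addnn; congr (_ + _)%N.
  by apply: eq_bigr => u _; rewrite adj_sym.
by rewrite [RHS](big_setD1 v vX) /= adj_irrefl.
Qed.

(** For $|X|=n+1$, deleting a vertex of at least average degree leaves at most
    $\frac{n-1}{n+1}\eta(n+1)^2\le\eta n^2$ pairs. *)
Lemma sparse_subset (R : realType) (G : sgraph) (X : {set G}) (eta : R)
    (s : nat) : 0 <= eta -> (s <= #|X|)%N ->
  (edges X X)%:R <= eta * #|X|%:R ^+ 2 ->
  exists Y : {set G}, [/\ Y \subset X, #|Y| = s &
    (edges Y Y)%:R <= eta * s%:R ^+ 2].
Proof.
move=> eta0; move: {2}(#|X| - s)%N (erefl (#|X| - s)%N) => m.
elim: m X => [|m IH] X hm sX hX.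
  have -> : s = #|X| by apply/eqP; rewrite eqn_leq sX -subn_eq0 hm.
  by exists X.
have lt : (s < #|X|)%N by rewrite -subn_gt0 hm.
have X0 : X != set0 by rewrite -card_gt0; apply: leq_ltn_trans lt.
pose deg v := (\sum_(u in X) adj v u)%N.
have [v vX] := exists_ge_average deg X0.
rewrite -/(edges X X) -(ler_nat R) natrM => hv.
have cX : #|X| = #|X :\ v|.+1 by rewrite (cardsD1 v) vX.
have [|||Y [YX cY hY]] := IH (X :\ v).
- by rewrite cX subSn in hm; [case: hm|rewrite -ltnS -cX].
- by rewrite -ltnS -cX.
- move: hv hX; rewrite (edges_setD1 vX) -/(deg v) cX.
  move: (edges _ _) (deg v) #|X :\ v| => e D n.
  rewrite natrD natrM -[n.+1]addn1 (natrD _ n 1).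
  have D0 : 0 <= D%:R :> R by [].
  have e0 : 0 <= e%:R :> R by [].
  (* The case $n=0$ is settled first, because the next estimate multiplies by $n-1\ge0$. *)
  case: n => [|n]; first by rewrite add0r mul1r => h1 h2; rewrite expr0n mulr0; lra.
  have n1 : 1 <= n.+1%:R :> R by rewrite ler1n.
  move: n.+1%:R e%:R D%:R n1 D0 e0 => {n e D}n e D n1 D0 e0 h1 h2.
  have h3 : (n + 1) * e <= (n - 1) * (eta * (n + 1) ^+ 2).
    have : (n - 1) * (e + 2 * D) <= (n - 1) * (eta * (n + 1) ^+ 2).
      by rewrite ler_wpM2l // subr_ge0.
    lra.
  have np : 0 < n + 1 by lra.
  rewrite -(ler_pM2l np); apply: le_trans h3 _.
  rewrite -subr_ge0 (_ : _ - _ = eta * (n + 1)); last by ring.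
  by rewrite mulr_ge0 // ltW.
by exists Y; split=> //; apply: subset_trans YX (subD1set _ _).
Qed.

(** Deleting an element of at most average weight does not lower the average. In use, [w v] counts
    the transversal cliques through [v]. *)
Lemma heavy_subset (R : realType) (T : finType) (w : T -> nat) (A : {set T})
    (d : R) (s : nat) : (s <= #|A|)%N ->
  d * #|A|%:R <= (\sum_(v in A) w v)%:R ->
  exists B : {set T}, [/\ B \subset A, #|B| = s &
    d * s%:R <= (\sum_(v in B) w v)%:R].
Proof.
move: {2}(#|A| - s)%N (erefl (#|A| - s)%N) => m.
elim: m A => [|m IH] A hm sA hA.
  have -> : s = #|A| by apply/eqP; rewrite eqn_leq sA -subn_eq0 hm.
  by exists A.
have lt : (s < #|A|)%N by rewrite -subn_gt0 hm.
have A0 : A != set0 by rewrite -card_gt0; apply: leq_ltn_trans lt.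
have [v vA] := exists_le_average w A0.
rewrite -(ler_nat R) natrM => hv.
have cA : #|A| = #|A :\ v|.+1 by rewrite (cardsD1 v) vA.
have [|||B [BA cB hB]] := IH (A :\ v).
- by rewrite cA subSn in hm; [case: hm|rewrite -ltnS -cA].
- by rewrite -ltnS -cA.
- move: hv hA; rewrite (big_setD1 v vA) /= cA.
  move: (bigop _ _ _) (w v) #|A :\ v| => e D n.
  rewrite natrD -[n.+1]addn1 (natrD _ n 1).
  have n1 : 0 <= n%:R :> R by [].
  move: n%:R e%:R D%:R n1 => {n e D}n e D n0 h1 h2.
  have np : 0 < n + 1 by lra.
  rewrite -(ler_pM2l np).
  have := ler_wpM2l n0 h2; lra.
by exists B; split=> //; apply: subset_trans BA (subD1set _ _).
Qed.

(** * Bicliques between sparse sets *)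

Lemma sparse_pair_biclique (R : realType) (F : sgraph -> Prop) (d : R) :
  dense_biclique R F -> 0 < d ->
  exists eta delta : R, [/\ 0 < eta, 0 < delta <= 1 &
  forall G, F G -> forall (X Y : {set G}) (s : nat), (0 < s)%N ->
    #|X| = s -> #|Y| = s -> d * s%:R ^+ 2 <= (edges X Y)%:R ->
    (edges X X)%:R <= eta * s%:R ^+ 2 -> (edges Y Y)%:R <= eta * s%:R ^+ 2 ->
    exists A B : {set G}, [/\ A \subset X, B \subset Y,
      delta * s%:R <= #|A|%:R, delta * s%:R <= #|B|%:R & complete A B]].
Proof.
(* As $|X\cup Y|\le2s$, the $ds^2$ pairs give the union density at least $d/4$. *)
move=> bF d0; have d40 : 0 < d / 4 by lra.
have [e [/andP[e0 e1] He]] := bF _ d40.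
(* Each side of the biclique has at least half of its vertices in [X] or at least half in [Y]. *)
pose c : R := e / 2; have c0 : 0 < c by rewrite /c; lra.
have c20 : 0 < c ^+ 2 by rewrite exprn_gt0.
(* A biclique with sides $cs$ inside one set has $c^2s^2$ pairs, twice what $\eta=c^2/2$ allows. *)
exists (c ^+ 2 / 2), c; split; [lra|by rewrite /c; lra|].
move=> G FG X Y s s0 cX cY dXY sX sY.
have s0R : 0 < s%:R :> R by rewrite ltr0n.
set V := X :|: Y.
have XV : X \subset V by apply: subsetUl.
have YV : Y \subset V by apply: subsetUr.
have sV : s%:R <= #|V|%:R :> R by rewrite ler_nat -cX subset_leq_card.
have V2 : #|V|%:R <= 2 * s%:R :> R.
  by rewrite -natrM ler_nat mul2n -addnn -{1}cX -cY leq_card_setU.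
have V0 : V != set0.
  by rewrite -card_gt0 -(ltr0n R); apply: lt_le_trans sV.
have [|A [B [AV BV hA hB cAB]]] := He G FG V V0.
  have : (edges X Y)%:R <= (edges V V)%:R :> R by rewrite ler_nat edges_mono.
  apply: le_trans; apply: le_trans dXY.
  have : #|V|%:R ^+ 2 <= (2 * s%:R) ^+ 2 :> R.
    by rewrite ler_sqr ?nnegrE ?mulr_ge0.
  by rewrite exprMn; nra.
(* A sparse X cannot contain both halves of a large biclique. *)
have noXX (Z C D : {set G}) : (edges Z Z)%:R <= c ^+ 2 / 2 * s%:R ^+ 2 ->
    C \subset Z -> D \subset Z -> c * s%:R <= #|C|%:R -> complete C D ->
    #|D|%:R < c * s%:R.
  move=> sZ CZ DZ hC cCD; rewrite ltNge; apply/negP => hD.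
  have := edges_mono CZ DZ; rewrite edges_complete // -(ler_nat R) natrM.
  have cs0 : 0 < c * s%:R by rewrite mulr_gt0.
  have h : (c * s%:R) ^+ 2 <= #|C|%:R * #|D|%:R.
    by rewrite expr2; apply: ler_pM => //; apply: ltW.
  have h2 : 0 < (c * s%:R) ^+ 2 by rewrite exprn_gt0.
  move=> h3; have := le_trans h (le_trans h3 sZ).
  by move: h2; rewrite exprMn; lra.
have half (C : {set G}) : C \subset V -> e * #|V|%:R <= #|C|%:R ->
    c * s%:R <= #|C :&: X|%:R \/ c * s%:R <= #|C :&: Y|%:R.
  move=> CV hC; have [|lt1] := leP (c * s%:R) #|C :&: X|%:R; first by left.
  right; have : (#|C| <= #|C :&: X| + #|C :&: Y|)%N.
    by rewrite -{1}(setIidPl CV) setIUr leq_card_setU.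
  have := ler_wpM2l (ltW e0) sV.
  by rewrite -(ler_nat R) natrD /c in lt1 *; lra.
have cAB' (C D : {set G}) : complete (A :&: C) (B :&: D).
  by apply: complete_sub cAB; apply: subsetIl.
have [hAX|hAY] := half A AV hA; have [hBX|hBY] := half B BV hB.
- have := noXX X _ _ sX (subsetIr A X) (subsetIr B X) hAX (cAB' X X).
  by rewrite ltNge hBX.
- by exists (A :&: X), (B :&: Y); rewrite !subsetIr.
- exists (B :&: X), (A :&: Y); rewrite !subsetIr; split=> //.
  exact: complete_sym.
- have := noXX Y _ _ sY (subsetIr A Y) (subsetIr B Y) hAY (cAB' Y Y).
  by rewrite ltNge hBY.
Qed.

(** Induction on [L]: the tail is treated first, then the head pair inside the resulting sets. All
    sets keep one common size, so that the density hypothesis applies to them again. *)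
Lemma sparse_tuple_bicliques (R : realType) (F : sgraph -> Prop) (d : R)
    (k : nat) (L : seq ('I_k * 'I_k)) :
  dense_biclique R F -> 0 < d -> all (fun p => p.1 != p.2) L ->
  exists eta delta : R, [/\ 0 < eta, 0 < delta <= 1 &
  forall G, F G -> forall (X : 'I_k -> {set G}) (s : nat), (0 < s)%N ->
    (forall i, #|X i| = s) ->
    (forall i, (edges (X i) (X i))%:R <= eta * s%:R ^+ 2) ->
    (forall i j (A B : {set G}) t, i != j -> A \subset X i -> B \subset X j ->
       #|A| = t -> #|B| = t -> delta * s%:R <= t%:R ->
       d * t%:R ^+ 2 <= (edges A B)%:R) ->
    exists (Z : 'I_k -> {set G}) (t : nat),
      [/\ forall i, Z i \subset X i /\ #|Z i| = t, delta * s%:R <= t%:R &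
        forall p, p \in L -> complete (Z p.1) (Z p.2)]].
Proof.
move=> bF d0; elim: L => [_|[i j] L IH /= /andP[nij aL]].
  exists 1, 1; split; rewrite ?ltr01 ?lexx // => G _ X s _ cX _ _.
  by exists X, s; split=> //; rewrite mul1r.
have [eta1 [e1 [eta10 /andP[e10 e11] H1]]] := sparse_pair_biclique bF d0.
have [eta2 [e2 [eta20 /andP[e20 e21] H2]]] := IH aL.
have e0 : 0 < e1 * e2 by rewrite mulr_gt0.
have ele : e1 * e2 <= e2 by rewrite ger_pMl.
(* Subsets of size $t\ge e_2s$ then span at most $\eta s^2\le\eta_1t^2$ pairs, so they are sparse
   enough for the head pair. *)
pose eta := Num.min eta2 (eta1 * e2 ^+ 2).
have le1 : eta <= eta2 by rewrite /eta ge_min lexx.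
have le2 : eta <= eta1 * e2 ^+ 2 by rewrite /eta ge_min lexx orbT.
exists eta, (e1 * e2); split.
- by rewrite /eta lt_min eta20 /= mulr_gt0 // exprn_gt0.
- by rewrite e0 (le_trans ele).
move=> G FG X s s0 cX sX lrX.
have s0R : 0 < s%:R :> R by rewrite ltr0n.
have [|a b A B t nab AX BX cA cB ht|Z [t [ZX ht cZ]]] := H2 G FG X s s0 cX.
- by move=> l; apply: le_trans (sX l) _; rewrite ler_wpM2r ?exprn_ge0.
- apply: (lrX a b) => //; apply: le_trans ht.
  by rewrite ler_wpM2r.
have e2s0 : 0 < e2 * s%:R by rewrite mulr_gt0.
have t0R : 0 < t%:R :> R := lt_le_trans e2s0 ht.
have sZ l : (edges (Z l) (Z l))%:R <= eta1 * t%:R ^+ 2.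
  have [Zl _] := ZX l.
  have : (edges (Z l) (Z l))%:R <= (edges (X l) (X l))%:R :> R.
    by rewrite ler_nat edges_mono.
  move/le_trans; apply; apply: le_trans (sX l) _.
  apply: (@le_trans _ _ (eta1 * e2 ^+ 2 * s%:R ^+ 2)).
    by rewrite ler_wpM2r // exprn_ge0.
  by rewrite -mulrA -exprMn (ler_wpM2l (ltW eta10)) ?ler_sqr ?nnegrE ?(ltW e2s0).
have [Zi ci] := ZX i; have [Zj cj] := ZX j.
have t0 : (0 < t)%N by rewrite -(ltr0n R).
have [|A [B [AZ BZ hA hB cAB]]] := H1 G FG (Z i) (Z j) t t0 ci cj _ (sZ i) (sZ j).
  apply: (lrX i j) => //; apply: le_trans ht.
  by rewrite ler_wpM2r.
(* The two sides may differ in size; all sets are cut to the smaller one, which keeps complete pairs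
   complete. *)
pose u := minn #|A| #|B|.
have hu : e1 * t%:R <= u%:R by rewrite /u; case: leqP.
have ut : (u <= t)%N.
  by apply: leq_trans (geq_minl _ _) _; rewrite -ci subset_leq_card.
have [A' A'A cA'] := subset_card (geq_minl #|A| #|B| : (u <= #|A|)%N).
have [B' B'B cB'] := subset_card (geq_minr #|A| #|B| : (u <= #|B|)%N).
have /fin_all_exists [W hW] l : exists W : {set G}, W \subset Z l /\ #|W| = u.
  have [|W WZ cW] := @subset_card _ (Z l) u; first by have [_ ->] := ZX l.
  by exists W.
pose Y l := if l == i then A' else if l == j then B' else W l.
have YZ l : Y l \subset Z l.
  rewrite /Y; case: eqP => [->|_]; first exact: subset_trans AZ.
  case: eqP => [->|_]; first exact: subset_trans BZ.
  by have [] := hW l.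
exists Y, u; split.
- move=> l; split; first by apply: subset_trans (YZ l) _; have [] := ZX l.
  by rewrite /Y; case: eqP => // _; case: eqP => // _; have [] := hW l.
- apply: le_trans hu; rewrite -mulrA; exact: (ler_wpM2l (ltW e10) ht).
- move=> p; rewrite inE => /orP[/eqP ->|pL] /=; last first.
    by apply: complete_sub (cZ p pL).
  rewrite /Y eqxx (negbTE (_ : j != i)) 1?eq_sym // eqxx.
  exact: complete_sub cAB.
Qed.

(** * Transversal cliques and their density *)

(** Functions rather than vertex sets are counted, so the [V i] may overlap; the final theorem takes
    each to be the whole vertex set. *)
Definition transversal_cliques (G : sgraph) (k : nat) (V : 'I_k -> {set G}) :
    {set {ffun 'I_k -> G}} :=
  [set x : {ffun 'I_k -> G} | [forall i, x i \in V i] &&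
           [forall i, forall j, (i != j) ==> adj (x i) (x j)]].

Definition upd (G : sgraph) (k : nat) (V : 'I_k -> {set G}) (i : 'I_k)
    (A : {set G}) : 'I_k -> {set G} :=
  fun l => if l == i then A else V l.

Section Transversals.
Variables (R : realType) (G : sgraph) (k : nat).
Implicit Types (V W : 'I_k -> {set G}) (A B : {set G}) (i j : 'I_k).

Lemma upd_id V i : upd V i (V i) = V.
Proof. by apply/funext => l; rewrite /upd; case: eqP => // ->. Qed.

Lemma updC V i j A B : i != j ->
  upd (upd V i A) j B = upd (upd V j B) i A.
Proof.
move=> nij; apply/funext => l; rewrite /upd.
by case: (l =P j) => // ->; rewrite eq_sym (negbTE nij).
Qed.

Lemma prod_upd V i A :
  (\prod_l #|upd V i A l| = #|A| * \prod_(l | l != i) #|V l|)%N.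
Proof.
rewrite (bigD1 i) //= /upd eqxx; congr (_ * _)%N.
by apply: eq_bigr => l /negbTE ->.
Qed.

Lemma prod_upd2 V i j A B : i != j ->
  (\prod_l #|upd (upd V i A) j B l| =
   #|A| * #|B| * \prod_(l | (l != i) && (l != j)) #|V l|)%N.
Proof.
move=> nij; rewrite updC // prod_upd -mulnA; congr (_ * _)%N.
rewrite (bigD1 j) /=; last by rewrite eq_sym.
rewrite /upd eqxx; congr (_ * _)%N.
by apply: eq_bigr => l /andP[_ /negbTE ->].
Qed.

Lemma card_transversal_cliques_le V :
  (#|transversal_cliques V| <= \prod_l #|V l|)%N.
Proof.
apply: (@leq_trans #|family (fun l => mem (V l))|).
  apply/subset_leq_card/subsetP => x; rewrite inE => /andP[/forallP xV _].
  exact/familyP.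
by rewrite card_family foldrE big_map big_enum.
Qed.

(** Sorting by the [i]-th vertex turns the count into a sum of weights over [A], as [heavy_subset]
    requires. *)
Lemma card_transversal_cliques_sum V i A :
  (#|transversal_cliques (upd V i A)| =
   \sum_(v in A) #|transversal_cliques (upd V i [set v])|)%N.
Proof.
have inA x A' : (x \in transversal_cliques (upd V i A')) =
   (x i \in A') && (x \in transversal_cliques (upd V i setT)).
  rewrite !inE andbA; congr (_ && _); apply/forallP/andP => [h|[xi /forallP h] l].
    have := h i; rewrite {1}/upd eqxx => ->; split=> //; apply/forallP => l.
    by have := h l; rewrite /upd; case: eqP; rewrite ?inE.
  by have := h l; rewrite /upd; case: eqP => [->|].
rewrite -sum1_card (partition_big (fun x : {ffun 'I_k -> G} => x i) (mem A)) /=;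
  last by move=> x; rewrite inA => /andP[].
apply: eq_bigr => v vA; rewrite sum1dep_card; apply: eq_card => x.
rewrite inE inA (inA x [set v]) !in_set1 andbC.
by case: eqP => [->|_] //=; rewrite vA.
Qed.

Lemma card_transversal_cliques_split V i A : A \subset V i ->
  (#|transversal_cliques V| = #|transversal_cliques (upd V i A)| +
   #|transversal_cliques (upd V i (V i :\: A))|)%N.
Proof.
move=> AV; rewrite -{1}(upd_id V i) card_transversal_cliques_sum.
rewrite (big_setID A) /= (setIidPr AV).
by congr (_ + _)%N; rewrite -card_transversal_cliques_sum.
Qed.

(** Once the [i]-th and [j]-th vertices are fixed, a nonadjacent pair extends to no clique and an
    adjacent one to at most $\prod_{l\ne i,j}|V_l|$. *)
Lemma card_transversal_cliques_le_edges V i j A B : i != j ->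
  (#|transversal_cliques (upd (upd V i A) j B)| <=
   edges A B * \prod_(l | (l != i) && (l != j)) #|V l|)%N.
Proof.
move=> nij; rewrite updC // card_transversal_cliques_sum /edges big_distrl /=.
apply: leq_sum => u uA; rewrite -updC // card_transversal_cliques_sum big_distrl /=.
apply: leq_sum => v vB; case uv: (adj u v).
  apply: leq_trans (card_transversal_cliques_le _) _.
  by rewrite prod_upd2 // !cards1 !mul1n.
rewrite mul0n leqn0 cards_eq0; apply/eqP/setP => x; rewrite in_set0 inE.
apply/negP => /andP[/forallP xV /forallP/(_ i)/forallP/(_ j)].
have := xV i; have := xV j; rewrite /upd eqxx (negbTE nij) eqxx !in_set1.
by move=> /eqP -> /eqP ->; rewrite uv.
Qed.

Lemma dense_subtuple V (d : R) (s : nat) : (forall i, (s <= #|V i|)%N) ->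
  d * (\prod_i #|V i|)%:R <= #|transversal_cliques V|%:R ->
  exists W, (forall i, W i \subset V i /\ #|W i| = s) /\
    d * s%:R ^+ k <= #|transversal_cliques W|%:R.
Proof.
move=> sV dV.
have [W [WV sW cW dW]] : exists W, [/\ forall i, W i \subset V i,
    forall i, (s <= #|W i|)%N, forall i, i \in enum 'I_k -> #|W i| = s &
    d * (\prod_i #|W i|)%:R <= #|transversal_cliques W|%:R].
  elim: (enum 'I_k) => [|i L [W [WV sW cW dW]]]; first by exists V.
  (* The sets are cut down one index at a time; the product of the other sizes joins [d] in the
     coefficient of [heavy_subset]. *)
  have := dW; rewrite -{1 2}(upd_id W i) prod_upd card_transversal_cliques_sum.
  rewrite mulnC natrM mulrA => h.
  have [B [BW cB hB]] := heavy_subset (sW i) h.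
  exists (upd W i B); split=> [l|l|l|].
  - by rewrite /upd; case: eqP => // ->; apply: subset_trans (WV i).
  - by rewrite /upd; case: eqP => // _; rewrite cB.
  - by rewrite inE /upd; case: eqP => // _ /= /cW.
  - by rewrite prod_upd card_transversal_cliques_sum mulnC natrM mulrA cB.
exists W; split=> [i|]; first by rewrite WV cW ?mem_enum.
move: dW; rewrite (eq_bigr (fun=> s)); first by rewrite prod_nat_const card_ord natrX.
by move=> i _; rewrite cW ?mem_enum.
Qed.

(** $A\times B$ fills $t^2$ of the $M^2$ pairs of $V_i\times V_j$ but carries less than half of its
    share of cliques, so one of two boxes covering the rest must be denser. *)
Lemma density_increment V (d0 d c : R) (M t : nat) i j A B :
  i != j -> (forall l, #|V l| = M) -> A \subset V i -> B \subset V j ->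
  #|A| = t -> #|B| = t -> (0 < t)%N -> (2 * t <= M)%N -> 0 < c -> c * M%:R <= t%:R ->
  0 < d0 <= d -> (edges A B)%:R < d0 / 2 * t%:R ^+ 2 ->
  d * M%:R ^+ k <= #|transversal_cliques V|%:R ->
  exists W, (forall l, (t <= #|W l|)%N) /\
    d * (1 + c ^+ 2 / 2) * (\prod_l #|W l|)%:R <= #|transversal_cliques W|%:R.
Proof.
move=> nij cV AV BV cA cB t0 tM c0 cMt /andP[d00 d0d] eAB dV.
have tMle : (t <= M)%N by apply: leq_trans tM; rewrite mul2n -addnn leq_addr.
have tMt : (t <= M - t)%N by rewrite leq_subRL // addnn -mul2n.
(* The rest of $V_i\times V_j$ splits into $A\times(V_j\setminus B)$ and $(V_i\setminus A)\times
   V_j$; by $2t\le M$ all sets keep size at least $t$. *)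
pose W1 := upd (upd V i A) j (V j :\: B).
pose W2 := upd V i (V i :\: A).
have cA' : #|V i :\: A| = (M - t)%N by rewrite cardsD (setIidPr AV) cV cA.
have cB' : #|V j :\: B| = (M - t)%N by rewrite cardsD (setIidPr BV) cV cB.
have sW1 l : (t <= #|W1 l|)%N.
  by rewrite /W1 /upd; case: eqP => _; rewrite ?cB' //; case: eqP => _;
    rewrite ?cA ?cV.
have sW2 l : (t <= #|W2 l|)%N.
  by rewrite /W2 /upd; case: eqP => _; rewrite ?cA' ?cV.
have [h1|h1] := leP (d * (1 + c ^+ 2 / 2) * (\prod_l #|W1 l|)%:R)
  #|transversal_cliques W1|%:R; first by exists W1.
have [h2|h2] := leP (d * (1 + c ^+ 2 / 2) * (\prod_l #|W2 l|)%:R)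
  #|transversal_cliques W2|%:R; first by exists W2.
exfalso; set P := (\prod_(l | (l != i) && (l != j)) #|V l|)%N.
have P0 : 0 < P%:R :> R.
  rewrite ltr0n prodn_gt0 // => l; rewrite cV; exact: leq_trans tMle.
have eV : (\prod_l #|V l| = M * M * P)%N.
  by have := prod_upd2 V (V i) (V j) nij; rewrite (upd_id V i) (upd_id V j) !cV.
have eW1 : (\prod_l #|W1 l| = t * (M - t) * P)%N by rewrite prod_upd2 // cA cB'.
have eW2 : (\prod_l #|W2 l| = (M - t) * M * P)%N.
  rewrite /W2; have := prod_upd2 V (V i :\: A) (V j) nij.
  by rewrite updC // (upd_id V j) cA' cV.
have Mk : M%:R ^+ k = M%:R * M%:R * P%:R :> R.
  rewrite -!natrM -eV (eq_bigr (fun=> M)) => [|l _]; last exact: cV.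
  by rewrite prod_nat_const card_ord natrX.
have := card_transversal_cliques_le_edges V A B nij.
rewrite -/P -(ler_nat R) natrM => h3.
have e3 : #|transversal_cliques V|%:R = #|transversal_cliques (upd (upd V i A) j B)|%:R
    + #|transversal_cliques W1|%:R + #|transversal_cliques W2|%:R :> R.
  rewrite (card_transversal_cliques_split AV).
  have Vj : upd V i A j = V j by rewrite /upd eq_sym (negbTE nij).
  by rewrite (@card_transversal_cliques_split (upd V i A) j B) Vj // !natrD.
move: dV h1 h2; rewrite Mk e3 eW1 eW2 !natrM (natrB _ tMle).
move: #|transversal_cliques W2|%:R #|transversal_cliques W1|%:R => z y.
move: #|transversal_cliques _|%:R h3 => x hx hS hy hz.
have t0R : 0 < t%:R :> R by rewrite ltr0n.
have M0 : 0 <= M%:R :> R by [].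
move: (edges A B)%:R t%:R M%:R P%:R eAB t0R M0 cMt P0 hx hS hy hz => e T N Q.
move=> eAB T0 N0 cNT Q0 hx hS hy hz.
have d0' : 0 < d by apply: lt_le_trans d0d.
have hg : c ^+ 2 * N ^+ 2 <= T ^+ 2.
  by rewrite -exprMn ler_sqr ?nnegrE ?mulr_ge0 // ltW.
have he : e * Q <= d / 2 * T ^+ 2 * Q.
  rewrite ler_pM2r //; apply: le_trans (ltW eAB) _.
  by apply: ler_wpM2r; [exact/exprn_ge0/ltW|lra].
(* The two boxes hold $N^2-T^2$ pairs, and the gain $\frac{c^2}{2}(N^2-T^2)$ stays below the deficit
   $\frac12T^2$ because $cN\le T$. *)
have key : d * (1 + c ^+ 2 / 2) * (T * (N - T) * Q) +
    d * (1 + c ^+ 2 / 2) * ((N - T) * N * Q) + d / 2 * T ^+ 2 * Q <=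
    d * (N * N * Q).
  rewrite -subr_ge0 (_ : _ - _ = d * Q / 2 *
    ((T ^+ 2 - c ^+ 2 * N ^+ 2) + c ^+ 2 * T ^+ 2)); last by field.
  apply: mulr_ge0; first by rewrite !mulr_ge0 ?invr_ge0 // ltW.
  by rewrite addr_ge0 ?subr_ge0 // mulr_ge0 ?exprn_ge0 // ltW.
have := le_trans hx he; move: key hS hy hz; clear; lra.
Qed.

End Transversals.

(** * Iterating the density increment *)

Lemma leq_triple_half (n : nat) : (2 <= n)%N -> (n <= 3 * n./2)%N.
Proof. by have := odd_double_half n; case: (odd n); lia. Qed.

Lemma nat_ceil (R : realType) (x : R) :
  exists s : nat, x <= s%:R /\ forall n : nat, x <= n%:R -> (s <= n)%N.
Proof.
have ex : exists n : nat, x <= n%:R by exists (Num.truncn x).+1; apply/ltW/truncnS_gt.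
by case: (ex_minnP ex) => s xs ms; exists s.
Qed.

Lemma has_parts_weaken (R : realType) (k : nat) (G : sgraph) (V W : {set G})
    (s t : R) : V \subset W -> t <= s -> has_parts k V s -> has_parts k W t.
Proof.
move=> VW ts [A [As Ac]]; exists A; split=> // i; have [AV sA] := As i.
by rewrite (subset_trans AV VW) (le_trans ts sA).
Qed.

(** Induction on [n], which bounds the increments possible before the density exceeds 1. [gamma] is
    chosen before the current density [d], so it stays fixed along the iteration. *)
Lemma dense_transversals_parts (R : realType) (F : sgraph -> Prop) (k : nat)
    (d0 : R) : dense_biclique R F -> 0 < d0 ->
  exists gamma : R, 0 < gamma /\
  forall (n : nat) (d : R), d0 <= d -> 1 < d * (1 + gamma) ^+ n ->
  exists c : R, 0 < c <= 1 /\
  forall G, F G -> forall (V : 'I_k -> {set G}) (M : nat), (0 < M)%N ->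
    (forall i, #|V i| = M) ->
    d * M%:R ^+ k <= #|transversal_cliques V|%:R ->
    has_parts k [set: G] (c * M%:R).
Proof.
move=> bF d00; have d020 : 0 < d0 / 2 by lra.
pose L := [seq p <- enum {: 'I_k * 'I_k} | p.1 != p.2].
have aL : all (fun p => p.1 != p.2) L by apply: filter_all.
have inL i j : i != j -> (i, j) \in L by rewrite mem_filter mem_enum /= => ->.
have [eta [e2 [eta0 /andP[e20 e21] H2]]] := sparse_tuple_bicliques bF d020 aL.
have [e1 [/andP[e10 e11] H1]] := sparse_or_parts k bF eta0.
pose c1 : R := Num.min e1 (1 / 3).
have c10 : 0 < c1 by rewrite /c1 lt_min e10; lra.
have c1e : c1 <= e1 by rewrite /c1 ge_min lexx.
have c13 : c1 <= 1 / 3 by rewrite /c1 ge_min lexx orbT.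
have c11 : c1 <= 1 by lra.
(* Lower bound for $t/M$, from $s\ge c_1M$ and $t\ge e_2s$. *)
pose c0 := c1 * e2.
have c00 : 0 < c0 by rewrite mulr_gt0.
have c0c1 : c0 <= c1 by rewrite ger_pMr.
exists (c0 ^+ 2 / 2); split; first by rewrite divr_gt0 ?exprn_gt0.
set g := c0 ^+ 2 / 2.
have g0 : 0 < g by rewrite divr_gt0 ?exprn_gt0.
elim=> [|n IH] d d0d; rewrite ?expr0 ?mulr1 => hd.
  (* With no increment left, $d>1$ contradicts the trivial bound $M^k$. *)
  exists 1; split=> [|G FG V M M0 cV dV]; first by rewrite ltr01 lexx.
  have := card_transversal_cliques_le V.
  rewrite (eq_bigr (fun=> M)) => [|l _]; last exact: cV.
  rewrite prod_nat_const card_ord -(ler_nat R) natrX => le.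
  have M0R : 0 < M%:R ^+ k :> R by rewrite exprn_gt0 // ltr0n.
  by have := le_trans dV le; rewrite ger_pMl // leNgt hd.
have d0' : 0 < d by apply: lt_le_trans d0d.
have [||c' [/andP[c'0 c'1] IHc]] := IH (d * (1 + g)).
- by apply: le_trans d0d _; rewrite ler_peMr ?ltW // ltrDl.
- by rewrite -mulrA -exprS.
have ce : c' * c0 <= c0 by rewrite ger_pMl.
exists (c' * c0); split; first by rewrite mulr_gt0 //; lra.
move=> G FG V M M0 cV dV.
have M0R : 0 < M%:R :> R by rewrite ltr0n.
(* For $M=1$ there is no room for $2s\le M$; one transversal clique gives singleton parts. *)
have [M2|M1] := leqP 2 M; last first.
  have {}M1 : M = 1%N by apply/eqP; rewrite eqn_leq M0 -ltnS M1.
  have : transversal_cliques V != set0.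
    rewrite -card_gt0 -(ltr0n R); apply: lt_le_trans dV.
    by rewrite mulr_gt0 ?exprn_gt0.
  case/set0Pn => x; rewrite inE => /andP[_ /forallP xa].
  exists (fun i => [set x i]); split=> [i|i j nij u v].
    by rewrite subsetT cards1 M1 mulr1; split=> //; lra.
  by move=> /set1P -> /set1P ->; have /forallP/(_ j) := xa i; rewrite nij.
apply: contrapT => nP.
have weak s : c' * c0 * M%:R <= s -> ~ has_parts k [set: G] s.
  by move=> hs; apply: contra_not nP; apply: has_parts_weaken.
have [s [hs ms]] := nat_ceil (c1 * M%:R).
have s0 : (0 < s)%N by rewrite -(ltr0n R); apply: lt_le_trans hs; rewrite mulr_gt0.
(* [s] is the ceiling of $c_1M\le M/3$, and $M/3\le\lfloor M/2\rfloor$ for $M\ge2$. *)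
have s2 : (2 * s <= M)%N.
  rewrite mul2n -geq_half_double; apply: ms.
  have := leq_triple_half M2; rewrite -(ler_nat R) natrM => h3.
  have := ler_wpM2r (ltW M0R) c13; lra.
(* A [V l] without a large sparse subset would already contain the parts. *)
have /fin_all_exists [X hX] l : exists X : {set G}, [/\ X \subset V l, #|X| = s &
    (edges X X)%:R <= eta * s%:R ^+ 2].
  have Vl0 : V l != set0 by rewrite -card_gt0 cV.
  case: (H1 G FG (V l) Vl0) => [/(has_parts_weaken (subsetT _) (lexx _)) hp|].
    exfalso; apply: weak hp; rewrite cV ler_wpM2r //; lra.
  move=> [X [XV hX sX]].
  have sle : (s <= #|X|)%N.
    apply: ms; apply: le_trans hX; rewrite cV; exact: ler_wpM2r.
  have [Y [YX cY sY]] := sparse_subset (ltW eta0) sle sX.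
  by exists Y; split=> //; apply: subset_trans XV.
have c0M (t : nat) : e2 * s%:R <= t%:R -> c0 * M%:R <= t%:R.
  move=> ht; apply: le_trans ht; rewrite /c0 (mulrC c1) -mulrA.
  exact: (ler_wpM2l (ltW e20)).
have [|l|i j A B t nij AX BX cA cB ht|Z [t [ZX ht cZ]]] := H2 G FG X s s0.
- by move=> l; have [] := hX l.
- by have [] := hX l.
(* A pair that is too sparse yields an increment; cut to the common size [t], the denser tuple falls
   under the induction hypothesis. *)
- rewrite leNgt; apply/negP => lt.
  have [XVi cXi _] := hX i; have [XVj _ _] := hX j.
  have t0 : (0 < t)%N.
    rewrite -(ltr0n R); apply: lt_le_trans ht; by rewrite mulr_gt0 ?ltr0n.
  have tM : (2 * t <= M)%N.
    by apply: leq_trans s2; rewrite leq_mul2l /= -cA -cXi subset_leq_card.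
  have dd : 0 < d0 <= d by rewrite d00.
  have [W [tW dW]] := density_increment nij cV (subset_trans AX XVi)
    (subset_trans BX XVj) cA cB t0 tM c00 (c0M t ht) dd lt dV.
  have [W' [W's W'd]] := dense_subtuple tW dW.
  apply: (weak (c' * t%:R)).
    by rewrite -mulrA; apply: (ler_wpM2l (ltW c'0)); apply: c0M.
  by apply: (IHc G FG W' t t0) => // l; have [] := W's l.
- apply: (weak t%:R).
    by apply: le_trans (c0M t ht); rewrite ler_wpM2r // ltW.
  exists Z; split=> [l|a b nab]; last exact: (cZ (a, b)) (inL _ _ nab).
  by rewrite subsetT; have [_ ->] := ZX l.
Qed.

(** * From clique density to $K_k[t]$ *)

Lemma contains_multipartite (R : realType) (k : nat) (G : sgraph)
    (V : {set G}) (s : R) : 0 <= s -> has_parts k V s ->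
  contains G (complete_multipartite k (Num.truncn s)).
Proof.
move=> s0 [A [As Ac]].
have tA i : (Num.truncn s <= #|A i|)%N.
  rewrite -(ler_nat R); have [_] := As i; apply: le_trans.
  by rewrite truncn_le.
pose phi (u : 'I_k * 'I_(Num.truncn s)) := enum_val (widen_ord (tA u.1) u.2).
have phiA u : phi u \in A u.1 by apply: enum_valP.
have aphi u v : u.1 != v.1 -> adj (phi u) (phi v).
  by move=> nuv; apply: (Ac _ _ nuv).
exists phi; split=> [u v e|]; last exact: aphi.
have e1 : u.1 = v.1.
  by apply/eqP; apply: contraT => /aphi; rewrite e adj_irrefl.
move: u v e e1 => [i a] [j b] /[swap] /= <-.
by move=> /enum_val_inj [/val_inj ->].
Qed.

(** Every copy of $K_k$ is the value set of some transversal clique, namely of an enumeration of its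
    vertices. *)
Lemma num_cliques_le_transversals (G : sgraph) (k : nat) :
  (num_cliques k G <= #|transversal_cliques (fun _ : 'I_k => [set: G])|)%N.
Proof.
pose im (x : {ffun 'I_k -> G}) := [set x i | i : 'I_k].
apply: leq_trans (leq_imset_card im _); apply/subset_leq_card/subsetP => S.
rewrite inE => /andP[/eqP cS /forall_inP clS]; apply/imsetP.
pose x := [ffun i : 'I_k => enum_val (cast_ord (esym cS) i)].
have xS i : x i \in S by rewrite ffunE; apply: enum_valP.
have xi : injective x by move=> i j; rewrite !ffunE => /enum_val_inj/cast_ord_inj.
exists x.
  rewrite inE; apply/andP; split; first by apply/forallP => i; rewrite inE.
  apply/forallP => i; apply/forallP => j; apply/implyP => nij.
  have /forall_inP/(_ _ (xS j))/implyP := clS _ (xS i); apply.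
  by rewrite (inj_eq xi).
apply/eqP; rewrite eq_sym eqEcard card_imset // card_ord cS leqnn andbT.
by apply/subsetP => _ /imsetP[i _ ->].
Qed.

(** Factor by factor, $n\le k(n-i)$ for $i<k\le n$. *)
Lemma expn_le_ffact (n k : nat) : (k <= n)%N -> (n ^ k <= k ^ k * n ^_ k)%N.
Proof.
move=> kn; rewrite ffact_prod.
have e m : (m ^ k = \prod_(i < k) m)%N by rewrite prod_nat_const card_ord.
rewrite {1}e (e k) -big_split /=; apply: leq_prod => -[i ik] _ /=; nia.
Qed.

Lemma exprn_unbounded (R : realType) (d g : R) : 0 < d -> 0 < g ->
  exists n : nat, 1 < d * (1 + g) ^+ n.
Proof.
move=> d0 g0; have dg0 : 0 < d * g by rewrite mulr_gt0.
exists (Num.truncn (d * g)^-1).+1; set n := _.+1.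
have h : 1 < d * g * n%:R by rewrite -ltr_pdivrMl // mulr1 truncnS_gt.
(* Bernoulli's inequality. *)
have : 1 + g * n%:R <= (1 + g) ^+ n.
  elim: n {h} => [|n IH]; first by rewrite mulr0 addr0 expr0.
  rewrite exprS -[n.+1]addn1 (natrD _ n 1).
  have g1 : 0 <= 1 + g by lra.
  have := ler_wpM2l g1 IH; have n0 : 0 <= g * (g * n%:R) by rewrite !mulr_ge0 // ltW.
  lra.
move=> /(ler_wpM2l (ltW d0)); lra.
Qed.

Theorem theorem1p9 (R : realType) (F : sgraph -> Prop) :
  hereditary F -> B_property R 2 F ->
  forall k : nat, (2 <= k)%N -> B_property R k F.
Proof.
move=> herF /(dense_biclique_of_B2 herF) bF k k2.
(* Positivity of [eps] sits under the existential so that choice yields a total [f]. *)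
suff /choice[f Hf] : forall eps : R, exists c : R, 0 < eps -> 0 < c /\
    forall G : sgraph, F G -> eps < clique_density R k G ->
    contains G (complete_multipartite k (Num.truncn (c * #|G|%:R))).
  by exists f; split=> eps /Hf[].
move=> eps; have [eps0|] := ltP 0 eps; last by exists 0.
(* Since $n^k\le k^k\,k!\binom nk$, density above $\varepsilon$ forces at least $(\varepsilon/K)n^k$
   transversal cliques. *)
pose K : R := (k ^ k)%:R * k`!%:R.
have kk0 : 0 < (k ^ k)%:R :> R by rewrite ltr0n; case: (k) => // m; rewrite expn_gt0.
have K0 : 0 < K by rewrite mulr_gt0 // ltr0n fact_gt0.
have d0 : 0 < eps / K by rewrite divr_gt0.
have [g [g0 Hg]] := dense_transversals_parts k bF d0.
have [n hn] := exprn_unbounded d0 g0.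
have [c [/andP[c0 _] Hc]] := Hg n _ (lexx _) hn.
exists c => _; split=> // G FG dens.
(* With fewer than [k] vertices the density is $0$, by the convention $x/0=0$. *)
have kG : (k <= #|G|)%N.
  rewrite leqNgt; apply/negP => lt; move: dens.
  by rewrite /clique_density bin_small // invr0 mulr0 ltNge ltW.
have G0 : (0 < #|G|)%N by apply: leq_trans kG; apply: ltnW.
apply: contains_multipartite; first by rewrite mulr_ge0 // ltW.
apply: (Hc G FG (fun=> setT) #|G| G0); first by move=> i; rewrite cardsT.
have C0 : 0 < 'C(#|G|, k)%:R :> R by rewrite ltr0n bin_gt0.
move: dens; rewrite /clique_density ltr_pdivlMr // => dens.
have := num_cliques_le_transversals G k; rewrite -(ler_nat R).
apply: le_trans; apply: le_trans (ltW dens).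
rewrite -mulrA ler_pM2l // ler_pdivrMl //.
by rewrite /K -mulrA -!natrM -natrX ler_nat mulnCA mulnC -mulnA bin_ffact expn_le_ffact.
Qed.
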